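(* Let $F$ be a probability distribution supported on $(0,\infty)$ with positive Lebesgue density $f$ on $(0,\infty)$, and assume that $f$ has bounded increase, i.e. $\delta_f>-\infty$. Let $h=f/\overline F$ and $M_1=\liminf_{x\to\infty}x\,h(x)$. Then $F\in\mathcal{E}$ if and only if $M_1>0$.
   Context: $\overline F=1-F$ is the right tail of $F$, and $h(x)=f(x)/\overline F(x)$ is the hazard rate. $F\in\mathcal{E}$ (extended rapidly varying tail) means that $\overline F^{\star}(u):=\limsup_{x\to\infty}\overline F(ux)/\overline F(x)<1$ for some $u>1$. For a positive function $g$ on $(0,\infty)$, the (sign-normalized) lower Matuszewska index $\delta_g\in[-\infty,\infty]$ is the supremum of those $\delta\in\mathbb{R}$ for which there is a constant $C>0$ such that for every $U>1$, as $x\to\infty$, $g(ux)/g(x)\le C(1+o(1))u^{-\delta}$ uniformly in $u\in[1,U]$ (with $\sup\emptyset=-\infty$). The density $f$ has bounded increase if $\delta_f>-\infty$. *)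

(* Defs.v *)
From HB Require Import structures.
From mathcomp Require Import all_boot all_order all_algebra.
From mathcomp Require Import all_classical all_reals all_analysis.
Import Order.TTheory GRing.Theory Num.Theory.
Import numFieldNormedType.Exports.

Set Implicit Arguments.
Unset Strict Implicit.
Unset Printing Implicit Defensive.

Local Open Scope classical_set_scope.
Local Open Scope ring_scope.

(* A distribution is a Borel probability P on R; this is the real-valued
   version of the library's cdf, applied to the identity random variable. *)
Definition distribution_function (R : realType)
    (P : probability (measurableTypeR R) R) (x : R) : R :=
  fine (P `]-oo, x]%classic).

Definition right_tail (R : realType) (F : R -> R) (x : R) : R := 1 - F x.

Definition hazard_rate (R : realType) (F f : R -> R) (x : R) : R :=
  f x / right_tail F x.

Definition tail_limsup (R : realType) (F : R -> R) (u : R) : \bar R :=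
  limf_esup (fun x : R => (right_tail F (u * x) / right_tail F x)%:E)
    (pinfty_nbhs R).

Definition extended_rapidly_varying (R : realType) (F : R -> R) : Prop :=
  exists u : R, 1 < u /\ (tail_limsup F u < 1)%E.

Definition M1 (R : realType) (F f : R -> R) : \bar R :=
  limf_einf (fun x : R => (x * hazard_rate F f x)%:E) (pinfty_nbhs R).

(* r is the o(1) term: it may depend on U but not on u in [1, U], which is
   the required uniformity. *)
Definition lower_matuszewska_bound (R : realType) (g : R -> R) (delta : R) :
    Prop :=
  exists C : R, 0 < C /\ forall U : R, 1 < U ->
    exists r : R -> R, r x @[x --> +oo] --> (0 : R) /\
      \forall x \near +oo, forall u : R, 1 <= u <= U ->
        g (u * x) / g x <= C * (1 + r x) * u `^ (- delta).

(* The supremum is taken in \bar R, where ereal_sup set0 = -oo. *)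
Definition lower_matuszewska_index (R : realType) (g : R -> R) : \bar R :=
  ereal_sup [set delta%:E | delta in lower_matuszewska_bound g].

Definition bounded_increase (R : realType) (g : R -> R) : Prop :=
  (-oo < lower_matuszewska_index g)%E.

(* P is carried by (0, +oo) and f is a positive Lebesgue density of P there;
   the values of f outside (0, +oo) are irrelevant. *)
Definition positive_density (R : realType)
    (P : probability (measurableTypeR R) R) (f : R -> R) : Prop :=
  [/\ P `]0, +oo[%classic = 1%E,
      measurable_fun (`]0, +oo[%classic : set (measurableTypeR R)) f,
      (forall x : R, 0 < x -> 0 < f x) &
      forall A : set (measurableTypeR R), measurable A -> A `<=` `]0, +oo[%classic ->
        P A = (\int[lebesgue_measure]_(x in A) (f x)%:E)%E].

(* Main.v *)
(** Write G for the right tail, so G(a) - G(b) is the integral of f over ]a, b].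
    If G(ux) <= q G(x) with q < 1, then (1 - q) G(x) is at most the integral of
    f over ]x, ux], and bounded increase bounds f there by K f(x); hence
    (1 - q) G(x) <= K (u - 1) x f(x).  Conversely, if y f(y) >= c G(y) for large
    y, then f >= c G(2x) / (2x) on ]x, 2x] because G is nonincreasing; hence
    G(x) - G(2x) >= (c / 2) G(2x). *)

Require Import Defs.
From mathcomp Require Import all_boot all_order all_algebra.
From mathcomp Require Import all_classical all_reals all_analysis.
From mathcomp Require Import measurable_realfun ring lra.
Import Order.TTheory GRing.Theory Num.Theory.
Import numFieldNormedType.Exports.

Set Implicit Arguments.
Unset Strict Implicit.
Unset Printing Implicit Defensive.

Local Open Scope classical_set_scope.
Local Open Scope ring_scope.

(** The limit superior is an infimum of suprema over neighbourhoods of [+oo], so some neighbourhood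
    has supremum below [a]; that supremum serves as [q]. *)
Lemma limf_esup_ltP (R : realType) (g : R -> R) (a : R) :
  (limf_esup (fun x => (g x)%:E) (pinfty_nbhs R) < a%:E)%E <->
  exists2 q, q < a & \forall x \near +oo, g x <= q.
Proof.
split.
- move=> /ereal_inf_lt[_ [V nV <-]] supV.
  have nVg : \forall x \near +oo, ((g x)%:E <= ereal_sup [set (g x)%:E | x in V])%E.
    by apply: filterS nV => x Vx; apply: ereal_sup_ubound; exists x.
  case: (ereal_sup _) supV nVg => [q| |] //= qa nVg.
    by exists q => //; apply: filterS nVg.
  (* The supremum is not [-oo], since the filter at [+oo] is proper and thus provides a point. *)
  by have [x] := @filter_ex _ _ _ _ nVg; rewrite leeNy_eq.
- move=> [q qa nq]; apply: (@le_lt_trans _ _ q%:E); last by rewrite lte_fin.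
  apply: (@le_trans _ _ (ereal_sup [set (g x)%:E | x in [set x | g x <= q]])).
    by apply: ereal_inf_lbound; exists [set x | g x <= q].
  by apply: ge_ereal_sup => _ [x gq <-]; rewrite lee_fin.
Qed.

Lemma limf_einf_gtP (R : realType) (g : R -> R) (a : R) :
  (a%:E < limf_einf (fun x => (g x)%:E) (pinfty_nbhs R))%E <->
  exists2 q, a < q & \forall x \near +oo, q <= g x.
Proof.
rewrite /limf_einf lteNr -EFinN.
have -> : (\- (fun x => (g x)%:E))%E = (fun x => (- g x)%:E) by [].
rewrite limf_esup_ltP; split=> -[q qa nq]; exists (- q).
- by rewrite ltrNr.
- by apply: filterS nq => x; rewrite lerNl.
- by rewrite ltrN2.
- by apply: filterS nq => x; rewrite lerN2.
Qed.

(** An index above [-oo] gives one admissible exponent [d], of either sign. On [[1, U]] the power is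
    at most [U]^ [|d|], and eventually [1 + r x < 2]. *)
Lemma bounded_increase_ratio_bound (R : realType) (g : R -> R) (U : R) :
  bounded_increase g -> 1 < U ->
  exists2 K, 0 < K & \forall x \near +oo,
    forall u, 1 <= u <= U -> g (u * x) / g x <= K.
Proof.
move=> /ereal_sup_gt[_ [d [C [C0 gC]] <-] _] U1.
have [r [r0 gr]] := gC _ U1.
have powle u : 1 <= u <= U -> u `^ (- d) <= U `^ `|d|.
  move=> /andP[u1 uU]; apply: (@le_trans _ _ (u `^ `|d|)).
    by apply: ler_powR => //; rewrite -normrN ler_norm.
  by apply: ge0_ler_powR; rewrite ?nnegrE ?normr_ge0//; lra.
exists (C * 2 * U `^ `|d|); first by rewrite !mulr_gt0// powR_gt0; lra.
have r1 : \forall x \near +oo, `|r x| < 1.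
  by move/cvgr0Pnorm_lt : r0; apply.
near=> x => u uU.
have grx : forall u, 1 <= u <= U -> g (u * x) / g x <= C * (1 + r x) * u `^ (- d).
  by near: x.
have : `|r x| < 1 by near: x.
rewrite ltr_norml => /andP[rN1 rx1].
apply: (le_trans (grx _ uU)).
by apply: ler_pM; rewrite ?powR_ge0 ?powle// ?ler_pM2l//; [rewrite mulr_ge0//; lra|lra].
Unshelve. all: by end_near. Qed.

Lemma integral_itv_cst (R : realType) (a b c : R) : a <= b ->
  (\int[lebesgue_measure]_(x in `]a, b]) (cst c%:E x) = (c * (b - a))%:E)%E.
Proof.
move=> ab; rewrite integral_cst//= lebesgue_measure_itv/= lte_fin.
by case: ltgtP ab => // -> _; rewrite subrr mulr0 mule0.
Qed.

Section positive_density_tail.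
Context (R : realType) (P : probability (measurableTypeR R) R) (f : R -> R).
Hypothesis fP : positive_density P f.

Local Notation tail := (right_tail (distribution_function P)).

Lemma right_tailE (x : R) : tail x = fine (P `]x, +oo[%classic).
Proof.
rewrite /right_tail /distribution_function.
have -> : `]x, +oo[%classic = ~` `]-oo, x]%classic.
  by rewrite setCitvl.
rewrite probability_setC//.
by have /fineK <- : P `]-oo, x]%classic \is a fin_num by exact: fin_num_measure.
Qed.

Lemma right_tail_ge0 (x : R) : 0 <= tail x.
Proof. by rewrite right_tailE fine_ge0. Qed.

(** Positivity of [a] keeps []a, b]] inside the half-line where [f] is the density of [P]. *)
Lemma right_tailB (a b : R) : 0 < a -> a <= b ->
  (tail a - tail b)%:E = (\int[lebesgue_measure]_(x in `]a, b]) (f x)%:E)%E.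
Proof.
move=> a0 ab; have [_ _ _ PE] := fP.
rewrite -PE//; last first.
  by move=> x /=; rewrite !in_itv/= andbT => /andP[/(lt_trans a0)].
rewrite !right_tailE.
have -> : `]a, +oo[%classic = `]a, b]%classic `|` `]b, +oo[%classic.
  by rewrite -itv_bndbnd_setU// bnd_simp.
rewrite measureU//; last first.
  by apply/seteqP; split=> x //=; rewrite !in_itv/= andbT => -[/andP[_]]; rewrite leNgt => /negP.
by rewrite fineD ?addrK ?fineK ?fin_num_measure.
Qed.

Lemma measurable_density (a b : R) : 0 < a ->
  measurable_fun (`]a, b]%classic : set (measurableTypeR R)) f.
Proof.
move=> a0; have [_ mf _ _] := fP.
apply: measurable_funS mf => // x /=.
by rewrite !in_itv/= andbT => /andP[/(lt_trans a0)].
Qed.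

Lemma right_tailB_le (a b c : R) : 0 < a -> a <= b ->
  (forall x, a < x <= b -> f x <= c) -> tail a - tail b <= c * (b - a).
Proof.
move=> a0 ab fc; have [_ _ f0 _] := fP.
rewrite -lee_fin right_tailB// -integral_itv_cst//.
apply: ge0_le_integral => //=.
- move=> x; rewrite in_itv/= lee_fin => /andP[ax _].
  by rewrite ltW// f0// (lt_trans a0).
- apply/measurable_EFinP; exact: measurable_density.
Qed.

Lemma right_tailB_ge (a b c : R) : 0 < a -> a <= b -> 0 <= c ->
  (forall x, a < x <= b -> c <= f x) -> c * (b - a) <= tail a - tail b.
Proof.
move=> a0 ab c0 fc.
rewrite -lee_fin right_tailB// -integral_itv_cst//.
apply: ge0_le_integral => //=.
- apply/measurable_EFinP; exact: measurable_density.
Qed.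

Lemma right_tail_nonincreasing (a b : R) : 0 < a -> a <= b -> tail b <= tail a.
Proof.
move=> a0 ab; have [_ _ f0 _] := fP.
rewrite -subr_ge0 -[0](mul0r (b - a)) right_tailB_ge// => x /andP[ax _].
by rewrite ltW// f0// (lt_trans a0).
Qed.

(** If the tail vanished at [a], it would vanish at [a + 1], so [f] would have integral zero over
    []a, a + 1]] and be zero almost everywhere there. As [f] is positive, this interval of length 1
    would be null. *)
Lemma right_tail_gt0 (a : R) : 0 < a -> 0 < tail a.
Proof.
move=> a0; have [_ _ f0 _] := fP.
rewrite lt_neqAle right_tail_ge0 andbT eq_sym; apply/negP => /eqP ta0.
have aa1 : a <= a + 1 by lra.
have := right_tailB a0 aa1.
have -> : tail (a + 1) = 0.
  by apply/eqP; rewrite eq_le right_tail_ge0 andbT -ta0 right_tail_nonincreasing.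
rewrite ta0 subrr => /esym int0.
have mf := measurable_density (b := a + 1) a0.
have : ae_eq lebesgue_measure (`]a, a + 1]%classic : set (measurableTypeR R))
    (EFin \o f) (cst 0%E).
  apply/ae_eq_integral_abs => //; first exact/measurable_EFinP.
  rewrite -[RHS]int0; apply: eq_integral => x; rewrite inE/= in_itv/= => /andP[ax _].
  by rewrite gtr0_norm// f0// (lt_trans a0).
move=> [N [mN N0 subN]].
have : (lebesgue_measure (`]a, (a + 1)%R]%classic : set (measurableTypeR R)) <= lebesgue_measure N)%E.
  apply: le_measure; rewrite ?inE//.
  move=> x ax; apply: subN => /= /(_ ax); case=> fx0.
  move: ax; rewrite /= in_itv/= => /andP[ax _].
  by have := f0 x (lt_trans a0 ax); rewrite fx0 ltxx.
by rewrite N0 lebesgue_measure_itv/= lte_fin ltrDl ltr01 lee_fin; lra.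
Qed.

End positive_density_tail.

Theorem theorem2p1 (R : realType) (P : probability (measurableTypeR R) R)
    (f : R -> R) :
  positive_density P f ->
  bounded_increase f ->
  (extended_rapidly_varying (distribution_function P) <->
   (0 < M1 (distribution_function P) f)%E).
Proof.
move=> fP fbi; have [_ _ f0 _] := fP.
set F := distribution_function P.
have t0 (x : R) : 0 < x -> 0 < right_tail F x by exact: right_tail_gt0 fP x.
rewrite limf_einf_gtP; split.
- move=> [u [u1 /limf_esup_ltP[q q1 nq]]].
  have [K K0 nK] := bounded_increase_ratio_bound fbi u1.
  have Ku0 : 0 < K * (u - 1) by rewrite mulr_gt0// subr_gt0.
  (* This comes from solving [(1 - q) G(x) <= K (u - 1) x f(x)] for [x f(x) / G(x)]. *)
  exists ((1 - q) / (K * (u - 1))); first by rewrite divr_gt0// subr_gt0.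
  near=> x.
  have x0 : 0 < x by near: x; apply: nbhs_pinfty_gt; rewrite num_real.
  have qx : right_tail F (u * x) / right_tail F x <= q by near: x.
  have Kx : forall v, 1 <= v <= u -> f (v * x) / f x <= K by near: x.
  rewrite ler_pdivrMr// /hazard_rate mulrA mulrAC ler_pdivlMr ?t0//.
  rewrite ler_pdivrMr ?t0// in qx.
  have xux : x <= u * x by rewrite ler_peMl ?ltW.
  (* Bounded increase is applied with ratio [y / x], which lies in [[1, u]]. *)
  have fle y : x < y <= u * x -> f y <= K * f x.
    move=> /andP[xy yux]; have := Kx (y / x).
    rewrite divfK ?gt_eqF// !ler_pdivrMr ?f0//; apply.
    by rewrite ler_pdivlMr// mul1r ltW.
  have := right_tailB_le fP x0 xux fle; rewrite -/F; nra.
- move=> [c c0 [M [Mreal cM]]]; exists 2; split; first lra.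
  (* The goal becomes [(1 + c / 2) G(2x) <= G(x)]. *)
  apply/limf_esup_ltP; exists (1 + c / 2)^-1.
    by rewrite invf_lt1; lra.
  near=> x.
  have x0 : 0 < x by near: x; apply: nbhs_pinfty_gt; rewrite num_real.
  (* The bound is needed on all of []x, 2x]], not only at [x]; hence the explicit threshold [M]. *)
  have cx : forall y, x <= y -> c <= y * hazard_rate F f y.
    move=> y xy; apply: cM; apply: lt_le_trans xy.
    by near: x; apply: nbhs_pinfty_gt.
  rewrite ler_pdivrMr ?t0// ler_pdivlMl; last lra.
  have fge y : x < y <= 2 * x -> c * right_tail F (2 * x) / (2 * x) <= f y.
    move=> /andP[xy yx]; have y0 := lt_trans x0 xy.
    have := cx y (ltW xy).
    rewrite /hazard_rate mulrA ler_pdivlMr ?t0// => cy.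
    rewrite ler_pdivrMr; last lra.
    have := right_tail_nonincreasing fP y0 yx; rewrite -/F => tle.
    have := f0 y y0; nra.
  have x2x : x <= 2 * x by lra.
  have := right_tailB_ge fP x0 x2x _ fge.
  have tx := t0 (2 * x) ltac:(lra).
  have -> : c * right_tail F (2 * x) / (2 * x) * (2 * x - x) = c / 2 * right_tail F (2 * x).
    by field; lra.
  (* The pending premise, nonnegativity of the lower bound on [f], is split off as a separate
     goal. *)
  rewrite -/F => /(_ _)/wrap[]; last lra.
  by rewrite !mulr_ge0 ?invr_ge0; lra.
Unshelve. all: by end_near. Qed.
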